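(* Let $\alpha(\mathcal G)$, $\alpha_{\mathrm{ess}}(\mathcal G)$ be the isoperimetric constants of the metric graph $\mathcal G$ and let $\alpha_d(\mathcal V)$, $\alpha_d^{\mathrm{ess}}(\mathcal V)$ be the discrete isoperimetric constants. Then $$\tfrac12\,\alpha(\mathcal G)\le\alpha_d(\mathcal V),\qquad \frac{2}{\alpha(\mathcal G)}\le\frac{1}{\alpha_d(\mathcal V)}+\ell^\ast(\mathcal G).$$ In particular, the isoperimetric constants at infinity satisfy $$\tfrac12\,\alpha_{\mathrm{ess}}(\mathcal G)\le\alpha_d^{\mathrm{ess}}(\mathcal V),\qquad \frac{2}{\alpha_{\mathrm{ess}}(\mathcal G)}\le\frac{1}{\alpha_d^{\mathrm{ess}}(\mathcal V)}+\ell^\ast_{\mathrm{ess}}(\mathcal G).$$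
   Context: Setting. $\mathcal G_d=(\mathcal V,\mathcal E)$ is an unoriented, connected, locally finite, simple graph with countably infinite $\mathcal V$ and $\mathcal E$. Each edge $e$ has a length $|e|\in(0,\infty)$ and $\mathcal G=(\mathcal V,\mathcal E,|\cdot|)$ is the metric graph. $\mathcal E_v$ is the set of edges incident to $v$, $\deg_{\mathcal G}(v)=\#\mathcal E_v$. Standing assumptions: $\ell^\ast(\mathcal G):=\sup_{e\in\mathcal E}|e|<\infty$ and $\deg_{\mathcal G}(v)\neq2$ for all $v$. At each degree-one vertex either a Dirichlet or a Neumann condition is imposed (for the Kirchhoff Laplacian on $\mathcal G$); $\mathcal V_D$ and $\mathcal V_N$ denote the corresponding sets of degree-one vertices. Put $\ell^\ast_{\mathrm{ess}}(\mathcal G)=\inf_{\widetilde{\mathcal E}}\sup_{e\in\mathcal E\setminus\widetilde{\mathcal E}}|e|$, the infimum over finite $\widetilde{\mathcal E}\subset\mathcal E$. Conventions $1/0=+\infty$, $1/\infty=0$. Isoperimetric constants of $\mathcal G$. $\mathcal K_{\mathcal G}$ is the set of finite connected subgraphs (with at least one edge). For $\widetilde{\mathcal G}=(\widetilde{\mathcal V},\widetilde{\mathcal E})\in\mathcal K_{\mathcal G}$: $\mathrm{mes}(\widetilde{\mathcal G})=\sum_{e\in\widetilde{\mathcal E}}|e|$, $\partial_{\mathcal G}\widetilde{\mathcal G}=\{v\in\widetilde{\mathcal V}:\ v\in\mathcal V_D\ \text{or}\ \deg_{\widetilde{\mathcal G}}(v)<\deg_{\mathcal G}(v)\}$, $\deg(\partial_{\mathcal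 G}\widetilde{\mathcal G})=\sum_{v\in\partial_{\mathcal G}\widetilde{\mathcal G}}\deg_{\widetilde{\mathcal G}}(v)$. Then $\alpha(\mathcal G)=\inf_{\widetilde{\mathcal G}\in\mathcal K_{\mathcal G}}\deg(\partial_{\mathcal G}\widetilde{\mathcal G})/\mathrm{mes}(\widetilde{\mathcal G})$ and $\alpha_{\mathrm{ess}}(\mathcal G)=\sup_{\widetilde{\mathcal G}\in\mathcal K_{\mathcal G}}\alpha(\mathcal G\setminus\widetilde{\mathcal G})$. Here $\mathcal G\setminus\widetilde{\mathcal G}$ carries Dirichlet conditions at its vertices having one or more edges in $\widetilde{\mathcal G}$ and unchanged conditions elsewhere, so that $\alpha(\mathcal G\setminus\widetilde{\mathcal G})$ is the infimum of $\deg(\partial_{\mathcal G}\mathcal Y)/\mathrm{mes}(\mathcal Y)$ over finite connected subgraphs $\mathcal Y$ consisting of edges not in $\widetilde{\mathcal G}$ (boundary taken with respect to $\mathcal G$). Discrete isoperimetric constants. $m(v)=\sum_{e\in\mathcal E_v}|e|$, $m(X)=\sum_{v\in X}m(v)$, and $\mathcal E_b(X)$ is the set of edges connecting $X$ with $\mathcal V\setminus X$. For $Y\subseteq\mathcal V$, $\alpha_d(Y)=\inf\{\#\mathcal E_b(X)/m(X):\ X\subseteq Y\text{ finite, nonempty}\}$, and $\alpha_d^{\mathrm{ess}}(\mathcal V)=\sup\{\alpha_d(\mathcal V\setminus X):X\subseteq\mathcal V\text{ finite}\}$.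
   Formalization: In the two lower bounds (for α and α_ess) the discrete constants are taken over finite sets of non-Dirichlet vertices, i.e. over V∖V_D instead of V; with V they fail, e.g. on an infinite comb with Dirichlet teeth. For V_D empty the statement is verbatim. *)

(* Defs.v *)
From HB Require Import structures.
From mathcomp Require Import all_boot all_order all_algebra finmap.
From mathcomp Require Import all_classical all_reals ereal.
Set Implicit Arguments.
Unset Strict Implicit.
Unset Printing Implicit Defensive.
Import Order.TTheory GRing.Theory Num.Theory.

Local Open Scope classical_set_scope.
Local Open Scope ring_scope.

(* An edge is the two-element set of its endpoints. *)

Definition star (V : choiceType) (E : set {fset V}) (v : V) : set {fset V} :=
  [set e | E e /\ v \in e].

Definition walk_connected (V : choiceType) (A : set V) (E : set {fset V}) :=
  forall u v, A u -> A v ->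
    exists p : seq V,
      path (fun x y => `[< E [fset x; y]%fset >]) u p /\ last u p = v.

Record metric_graph (R : realType) (V : choiceType) := MetricGraph {
  edges : set {fset V};
  len : {fset V} -> R;
  (* V_D; the remaining degree-one vertices carry Neumann conditions *)
  dirichlet : set V;
  vertices_countably_infinite : ([set: V] #= [set: nat])%card;
  edges_countably_infinite : (edges #= [set: nat])%card;
  edge_card : forall e, edges e -> #|` e| = 2%N;
  locally_finite : forall v, finite_set (star edges v);
  graph_connected : walk_connected [set: V] edges;
  len_gt0 : forall e, edges e -> 0 < len e;
  dirichlet_deg : forall v, dirichlet v -> #|` fset_set (star edges v)| = 1%N
}.

Section MetricGraph.
Variables (R : realType) (V : choiceType) (G : metric_graph R V).

Definition deg (v : V) : nat := #|` fset_set (star (edges G) v)|.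

Definition ell_star : \bar R := ereal_sup [set (len G e)%:E | e in edges G].

Definition ell_star_ess : \bar R :=
  ereal_inf [set ereal_sup [set (len G e)%:E | e in edges G `\` [set` F]]
            | F in [set F : {fset {fset V}} | [set` F] `<=` edges G]].

End MetricGraph.

Record subgraph (V : choiceType) := Subgraph {
  sub_vertices : {fset V};
  sub_edges : {fset {fset V}}
}.

Section Isoperimetric.
Variables (R : realType) (V : choiceType) (G : metric_graph R V).

Definition finite_connected_subgraphs : set (subgraph V) :=
  [set H | [/\ sub_edges H != fset0,
               [set` sub_edges H] `<=` edges G,
               forall e, e \in sub_edges H -> (e `<=` sub_vertices H)%fset &
               walk_connected [set` sub_vertices H] [set` sub_edges H]]].

Definition sub_deg (H : subgraph V) (v : V) : nat :=
  #|` [fset e in sub_edges H | v \in e]%fset|.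

Definition mes (H : subgraph V) : R := \sum_(e <- sub_edges H) len G e.

Definition boundary (H : subgraph V) : {fset V} :=
  [fset v in sub_vertices H |
    `[< dirichlet G v >] || (sub_deg H v < deg G v)%N]%fset.

Definition deg_boundary (H : subgraph V) : nat :=
  (\sum_(v <- boundary H) sub_deg H v)%N.

Definition isoperimetric (K : set (subgraph V)) : \bar R :=
  ereal_inf [set ((deg_boundary H)%:R / mes H)%:E | H in K].

Definition alpha : \bar R := isoperimetric finite_connected_subgraphs.

(* The constant of G \ H. Every vertex of G \ H having an edge in H is a
   Dirichlet vertex there, so the boundary of Y in G \ H is its boundary in G. *)
Definition alpha_minus (H : subgraph V) : \bar R :=
  isoperimetric (finite_connected_subgraphs `&`
    [set Y | [disjoint sub_edges Y & sub_edges H]%fset]).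

Definition alpha_ess : \bar R :=
  ereal_sup [set alpha_minus H | H in finite_connected_subgraphs].

Definition vertex_weight (v : V) : R :=
  \sum_(e <- fset_set (star (edges G) v)) len G e.

Definition set_weight (X : {fset V}) : R := \sum_(v <- X) vertex_weight v.

Definition edge_boundary (X : {fset V}) : set {fset V} :=
  [set e | edges G e /\
    exists x y, [/\ x \in X, y \notin X & e = [fset x; y]%fset]].

Definition alpha_d (Y : set V) : \bar R :=
  ereal_inf [set (#|` fset_set (edge_boundary X)|%:R / set_weight X)%:E
            | X in [set X : {fset V} | X != fset0 /\ [set` X] `<=` Y]].

Definition alpha_d_ess (Y : set V) : \bar R :=
  ereal_sup [set alpha_d (Y `\` [set` X]) | X in [set: {fset V}]].

End Isoperimetric.

(* Main.v *)
(* Lower bounds: for a finite set [X] of non-Dirichlet vertices, let [F] be the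
   set of edges incident with [X]. Every vertex of [X] is interior to [F], so
   each edge of [F] has at most one boundary endpoint, and has one only if it
   lies in [E_b(X)]; hence [deg(dF) <= #E_b(X)], while [m(X) <= 2 mes(F)]. As
   [F] may be disconnected, one passes to a component whose ratio [deg/mes] is
   at most that of [F] (mediant inequality).
   Upper bounds: if [X] is the set of interior vertices of a connected subgraph
   [Y], then [#E_b(X) <= deg(dY)] and
   [2 mes(Y) <= m(X) + deg(dY) sup |e| <= deg(dY) (1 / alpha_d + sup |e|)].
   Both arguments work verbatim for subgraphs avoiding a finite set of edges. At
   infinity this requires only that any finite set of edges be contained in a
   finite connected subgraph. *)
Require Import Defs.
From mathcomp Require Import all_boot all_order all_algebra finmap.
From mathcomp Require Import all_classical all_reals ereal.
From mathcomp Require Import lra.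
Set Implicit Arguments.
Unset Strict Implicit.
Unset Printing Implicit Defensive.
Import Order.TTheory GRing.Theory Num.Theory.
Local Open Scope classical_set_scope.
Local Open Scope ring_scope.

(** * Inequalities between quotients *)

Lemma mediant (R : realFieldType) (a b c d : R) : 0 < b -> 0 < d ->
  a / b <= (a + c) / (b + d) \/ c / d <= (a + c) / (b + d).
Proof.
move=> b0 d0; have bd0 : 0 < b + d by exact: addr_gt0.
case: (leP (a * d) (c * b)) => h; [left|right];
  rewrite ler_pdivrMr// mulrAC ler_pdivlMr//; lra.
Qed.

(** Turns an upper bound on 2 over an infimum into a lower bound on each ratio. When [t = 0] the
    hypothesis reads [+oo <= b], and the conclusion holds by the convention that the inverse of
    [+oo] is 0. *)
Lemma lee_div_of_div_le (R : realType) (b : \bar R) (t : R) :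
  (0 <= b)%E -> 0 <= t ->
  (2%:E / t%:E <= b -> 2%:E / b <= t%:E)%E.
Proof.
case: b => [r| |]// r0 t0; last by rewrite invey mule0 lee_fin.
rewrite lee_fin in r0; rewrite !inver.
have [->|tN0] := eqVneq t 0.
  by rewrite gt0_muley ?lte_fin// leye_eq.
have tp : (0 < t) by rewrite lt_neqAle eq_sym tN0.
rewrite -EFinM lee_fin => tr.
have rp : (0 < r) by apply: lt_le_trans tr; rewrite divr_gt0.
by rewrite gt_eqF// -EFinM lee_fin ler_pdivrMr// mulrC -ler_pdivrMr.
Qed.

(** * Reachability by walks *)

Section Reachability.
Variable V : choiceType.
Implicit Types (E : set {fset V}) (u v w : V).

Definition reachable E u v := exists p : seq V,
  path (fun x y => `[< E [fset x; y]%fset >]) u p /\ last u p = v.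

Lemma reachable_refl E u : reachable E u u.
Proof. by exists [::]. Qed.

Lemma reachable_edge E u v : E [fset u; v]%fset -> reachable E u v.
Proof. by move=> uv; exists [:: v]; split=> //=; rewrite andbT; apply/asboolP. Qed.

Lemma reachable_trans E v u w :
  reachable E u v -> reachable E v w -> reachable E u w.
Proof.
move=> [p [up <-]] [q [vq <-]]; exists (p ++ q).
by rewrite cat_path last_cat up.
Qed.

Lemma reachable_sym E u v : reachable E u v -> reachable E v u.
Proof.
move=> [p [+ <-]]; elim: p u => [|x p IH] u /=; first by move=> _; exact: reachable_refl.
move=> /andP[/asboolP ux /IH xp]; apply: reachable_trans xp _.
by apply: reachable_edge; rewrite fsetUC.
Qed.

Lemma reachable_sub E E' u v : E `<=` E' -> reachable E u v -> reachable E' u v.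
Proof.
move=> EE' [p [up <-]]; exists p; split=> //.
by apply: sub_path up => x y /asboolP /EE' xy; apply/asboolP.
Qed.

Lemma walk_connected_root (A : set V) E u :
  (forall v, A v -> reachable E u v) -> walk_connected A E.
Proof.
move=> root v w /root uv /root uw.
by apply: (@reachable_trans _ u) => //; apply: reachable_sym.
Qed.

End Reachability.

(** * Edges, stars and incidence counting *)

Section MetricGraphTheory.
Variables (R : realType) (V : choiceType) (G : metric_graph R V).
Implicit Types (e : {fset V}) (F S : {fset {fset V}}) (X : {fset V}).
Implicit Types (H : subgraph V) (u v w x y : V).

Lemma edge_nonempty e : edges G e -> exists v, v \in e.
Proof. by move=> Ge; apply/fset0Pn; rewrite -cardfs_gt0 (edge_card Ge). Qed.

Lemma edge_pair e v : edges G e -> v \in e ->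
  exists2 w, w != v & e = [fset v; w]%fset.
Proof.
move=> /edge_card Ge ve.
have : #|` e `\ v|%fset == 1%N by move: Ge; rewrite (cardfsD1 v) ve add1n => -[->].
move=> /cardfs1P[w ew]; have : w \in (e `\ v)%fset by rewrite ew inE.
rewrite !inE => /andP[wv _]; exists w => //.
by rewrite -ew fsetD1K.
Qed.

(** As [V] is infinite there is another vertex, and a walk to it starts with an edge at [v]. Vertex
    weights are therefore positive. *)
Lemma exists_incident_edge v : exists2 e, edges G e & v \in e.
Proof.
have infV : infinite_set ([set: V] `\` [set v]).
  apply: infinite_setD => //.
  by rewrite (eq_finite_set (vertices_countably_infinite G)); exact: infinite_nat.
have [w [_ /= wv]] : ([set: V] `\` [set v]) !=set0.
  by apply/set0P/eqP => V0; apply: infV; rewrite V0.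
have [[|x p] [/= + lastp]] := @graph_connected _ _ G v w I I.
  by rewrite lastp in wv.
by move=> /andP[/asboolP vx _]; exists [fset v; x]%fset; rewrite // !inE eqxx.
Qed.

Lemma mem_star v e : (e \in fset_set (star (edges G) v)) = `[< edges G e >] && (v \in e).
Proof.
rewrite in_fset_set; last exact: locally_finite.
apply/idP/andP => [/set_mem[/asboolP]//|[/asboolP Ge ve]].
exact/mem_set.
Qed.

(** Double counting. It turns vertex weights and boundary degrees into sums over edges, so that
    later estimates can be made edge by edge. *)
Lemma incidence_sum (M : nmodType) X F (f : {fset V} -> M) :
  \sum_(v <- X) \sum_(e <- F | v \in e) f e =
  \sum_(e <- F) f e *+ #|` e `&` X|%fset.
Proof.
rewrite (exchange_big_dep xpredT)//=; apply: eq_bigr => e _.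
rewrite big_fset_condE big_const_seq count_predT iter_addr_0.
congr (_ *+ size (enum_fset _)).
by apply/fsetP => v; rewrite !inE andbC.
Qed.

Lemma sum_sub_deg X H :
  (\sum_(v <- X) sub_deg H v)%:R =
  \sum_(e <- sub_edges H) #|` e `&` X|%fset%:R :> R.
Proof.
rewrite natr_sum -(incidence_sum X (sub_edges H) (fun=> 1)).
apply: eq_bigr => v _.
by rewrite big_fset_condE big_const_seq count_predT iter_addr_0.
Qed.

Lemma deg_boundaryE H : (deg_boundary G H)%:R =
  \sum_(e <- sub_edges H) #|` e `&` boundary G H|%fset%:R :> R.
Proof. exact: sum_sub_deg. Qed.

Lemma mes_gt0 H : sub_edges H != fset0 -> [set` sub_edges H] `<=` edges G ->
  0 < mes G H.
Proof.
move=> /fset0Pn[e eH] HG; rewrite /mes (big_fsetD1 e)//= ltr_pwDl//.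
  by apply: len_gt0; exact: HG.
rewrite big_seq; apply: sumr_ge0 => f; rewrite !inE => /andP[_ fH].
by apply/ltW/len_gt0/HG.
Qed.

(** * Reduction to connected subgraphs *)

Definition edge_subgraph F := Subgraph (\bigcup_(e <- F) e)%fset F.

Lemma edge_sub_vertices F e : e \in F -> (e `<=` sub_vertices (edge_subgraph F))%fset.
Proof. by move=> eF; apply: bigfcup_sup. Qed.

(** The closure condition makes [C] a union of components of [F]: at a vertex touched by [C] both
    subgraphs have the same edges, hence the same degree and boundary status. *)
Lemma deg_boundary_part (C F : {fset {fset V}}) : (C `<=` F)%fset ->
  (forall e f x, e \in C -> f \in F -> x \in e -> x \in f -> f \in C) ->
  (deg_boundary G (edge_subgraph C))%:R =
  \sum_(e <- C) #|` e `&` boundary G (edge_subgraph F)|%fset%:R :> R.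
Proof.
move=> /fsubsetP CF closed; rewrite deg_boundaryE /= big_seq [RHS]big_seq.
apply: eq_bigr => e eC; congr ((#|` _|)%:R).
apply/fsetP => x; rewrite !inE; case: (boolP (x \in e)) => //= xe.
have xC := fsubsetP (edge_sub_vertices eC) x xe.
have xF := fsubsetP (edge_sub_vertices (CF _ eC)) x xe.
rewrite /= in xC xF; rewrite xC xF /=; congr (_ || (#|` _| < _)%N).
apply/fsetP => f; rewrite !inE /=.
case: (boolP (x \in f)) => xf; rewrite ?andbF ?andbT//.
by apply/idP/idP => [/CF//|fF]; apply: closed eC fF xe xf.
Qed.

Definition bdry_ratio H : R := (deg_boundary G H)%:R / mes G H.

(** [C] is the set of edges reachable from some vertex [u], [D] the rest. They share no vertex, so
    boundary degree and measure both add up, and the mediant inequality applies. *)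
Lemma edge_subgraph_split F : F != fset0 -> [set` F] `<=` edges G ->
  ~ walk_connected [set` sub_vertices (edge_subgraph F)] [set` F] ->
  exists C D, [/\ C != fset0, D != fset0, (C `<` F)%fset, (D `<` F)%fset &
    bdry_ratio (edge_subgraph C) <= bdry_ratio (edge_subgraph F) \/
    bdry_ratio (edge_subgraph D) <= bdry_ratio (edge_subgraph F)].
Proof.
move=> F0 FG.
move=> /existsNP[u /existsNP[v /not_implyP[/= uF /not_implyP[/= vF nuv]]]].
(* One reachable endpoint suffices, since the edge itself then leads to the other one. *)
pose P e := `[< exists2 x, x \in e & reachable [set` F] u x >].
have PE e : e \in F -> P e -> forall x, x \in e -> reachable [set` F] u x.
  move=> eF /asboolP[y ye uy] x xe; have [->//|yx] := eqVneq x y.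
  have [z zy ez] := edge_pair (FG _ eF) ye.
  move: xe; rewrite ez !inE (negbTE yx) /= => /eqP xz; subst z.
  by apply: reachable_trans uy _; apply: reachable_edge; rewrite /= -ez.
have PI e f x : e \in F -> f \in F -> x \in e -> x \in f -> P e -> P f.
  by move=> eF fF xe xf Pe; apply/asboolP; exists x => //; exact: PE Pe _ xe.
move: uF => /bigfcupP[e /andP[eF _] ue].
move: vF => /bigfcupP[f /andP[fF _] vf].
have Pe : P e by apply/asboolP; exists u => //; exact: reachable_refl.
have nPf : ~~ P f by apply/negP => Pf; apply: nuv; exact: PE Pf _ vf.
pose C := [fset g in F | P g]%fset; pose D := [fset g in F | ~~ P g]%fset.
have C0 : C != fset0 by apply/fset0Pn; exists e; rewrite !inE /= eF.
have D0 : D != fset0 by apply/fset0Pn; exists f; rewrite !inE /= fF.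
have CF : (C `<=` F)%fset by apply/fsubsetP => g; rewrite !inE => /andP[].
have DF : (D `<=` F)%fset by apply/fsubsetP => g; rewrite !inE => /andP[].
exists C, D; split=> //.
- rewrite fproperEneq CF andbT; apply/eqP => CE.
  by move: fF; rewrite -CE !inE /= (negbTE nPf) andbF.
- rewrite fproperEneq DF andbT; apply/eqP => DE.
  by move: eF; rewrite -DE !inE /= Pe andbF.
have split_sum (g : {fset V} -> R) :
    \sum_(a <- F) g a = \sum_(a <- C) g a + \sum_(a <- D) g a.
  by rewrite (bigID P)/= (big_fset_condE _ F P) (big_fset_condE _ F (predC P)).
have mF : mes G (edge_subgraph F) = mes G (edge_subgraph C) + mes G (edge_subgraph D).
  exact: split_sum.
have dF : (deg_boundary G (edge_subgraph F))%:R =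
    (deg_boundary G (edge_subgraph C))%:R + (deg_boundary G (edge_subgraph D))%:R :> R.
  rewrite deg_boundaryE split_sum; congr (_ + _).
    rewrite (deg_boundary_part CF)// => g h x; rewrite !inE /=.
    by move=> /andP[gF Pg] hF xg xh; rewrite hF (PI _ _ _ gF hF xg xh Pg).
  rewrite (deg_boundary_part DF)// => g h x; rewrite !inE /=.
  move=> /andP[gF Pg] hF xg xh; rewrite hF /=; apply: contra Pg.
  exact: PI hF gF xh xg.
rewrite /bdry_ratio mF dF; apply: mediant; apply: mes_gt0 => //=.
  by move=> g /= /(fsubsetP CF); exact: FG.
by move=> g /= /(fsubsetP DF); exact: FG.
Qed.

(** Strong induction on the number of edges: a disconnected set has a strictly smaller part whose
    ratio is no larger. *)
Lemma connected_bdry_ratio_le F : F != fset0 -> [set` F] `<=` edges G ->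
  exists H, [/\ finite_connected_subgraphs G H, (sub_edges H `<=` F)%fset &
    bdry_ratio H <= bdry_ratio (edge_subgraph F)].
Proof.
have [n] := ubnP #|` F|; elim: n F => // n IH F Fn F0 FG.
have [conn|/(edge_subgraph_split F0 FG)] :=
    pselect (walk_connected [set` sub_vertices (edge_subgraph F)] [set` F]).
  exists (edge_subgraph F); split=> //=.
  by split=> //= e; exact: edge_sub_vertices.
have part C : C != fset0 -> (C `<` F)%fset ->
    bdry_ratio (edge_subgraph C) <= bdry_ratio (edge_subgraph F) ->
    exists H, [/\ finite_connected_subgraphs G H, (sub_edges H `<=` F)%fset &
      bdry_ratio H <= bdry_ratio (edge_subgraph F)].
  move=> C0 CF Cle.
  have [||H [KH HC Hle]] := IH C _ C0.
  - by apply: leq_trans (fproper_ltn_card CF) _.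
  - by move=> e /= /(fsubsetP (fproper_sub CF)); exact: FG.
  exists H; split=> //; first exact: fsubset_trans HC (fproper_sub CF).
  exact: le_trans Hle Cle.
by move=> [C [D [C0 D0 CF DF [Cle|Dle]]]]; [exact: part C0 CF Cle|exact: part D0 DF Dle].
Qed.

(** * Vertex sets compared with the subgraphs of their edges *)

Lemma set_weight_sum X F : [set` F] `<=` edges G ->
  (forall v, v \in X -> star (edges G) v `<=` [set` F]) ->
  set_weight G X = \sum_(e <- F) len G e *+ #|` e `&` X|%fset.
Proof.
move=> FG XF; rewrite -incidence_sum /set_weight big_seq [RHS]big_seq.
apply: eq_bigr => v vX; rewrite big_fset_condE; congr (\sum_(e <- enum_fset _) _).
apply/fsetP => e; rewrite mem_star !inE /=.
apply/andP/andP => [[/asboolP Ge ve]|[eF ve]]; split=> //.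
  by apply: (XF v).
exact/asboolP/FG.
Qed.

(** Every boundary edge has an endpoint in [X], so it lies in [F] and can be counted there. *)
Lemma card_edge_boundary X F : [set` F] `<=` edges G ->
  (forall v, v \in X -> star (edges G) v `<=` [set` F]) ->
  #|` fset_set (edge_boundary G X)|%:R =
  \sum_(e <- F) (`[< edge_boundary G X e >] : nat)%:R :> R.
Proof.
move=> FG XF.
have bF : edge_boundary G X `<=` [set` F].
  move=> e [Ge [x [y [xX _ ee]]]]; apply: (XF x) => //; split=> //.
  by rewrite ee !inE eqxx.
have -> : fset_set (edge_boundary G X) = [fset e in F | `[< edge_boundary G X e >]]%fset.
  apply/fsetP => e; rewrite in_fset_set; last exact: sub_finite_set (finite_fset F).
  rewrite !inE /=; apply/idP/andP => [/set_mem eb|[_ /asboolP eb]].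
    by split; [exact: bF|exact/asboolP].
  exact/mem_set.
rewrite -natr_sum card_fset_sum1 -big_fset_condE big_mkcond /=.
by congr (_%:R); apply: eq_bigr => e _; case: asboolP.
Qed.

Definition incident_edges X := (\bigcup_(v <- X) fset_set (star (edges G) v))%fset.

Lemma star_incident_edges X v : v \in X ->
  star (edges G) v `<=` [set` incident_edges X].
Proof.
move=> vX e [Ge ve]; apply/bigfcupP; exists v; rewrite ?vX// mem_star ve andbT.
exact/asboolP.
Qed.

Lemma incident_edgesP X e : e \in incident_edges X ->
  edges G e /\ exists2 v, v \in X & v \in e.
Proof.
move=> /bigfcupP[v /andP[vX _]]; rewrite mem_star => /andP[/asboolP Ge ve].
by split=> //; exists v.
Qed.

Lemma set_weight_gt0 X : X != fset0 -> 0 < set_weight G X.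
Proof.
move=> /fset0Pn[v vX].
have wge0 w : 0 <= vertex_weight G w.
  rewrite /vertex_weight big_seq; apply: sumr_ge0 => e.
  by rewrite mem_star => /andP[/asboolP Ge _]; exact/ltW/len_gt0.
rewrite /set_weight (big_fsetD1 v)//= ltr_pwDl//; last exact: sumr_ge0.
rewrite /vertex_weight; have [e Ge ve] := exists_incident_edge v.
rewrite (big_fsetD1 e)/=; last by rewrite mem_star ve andbT; exact/asboolP.
rewrite ltr_pwDl//; first exact: len_gt0.
rewrite big_seq; apply: sumr_ge0 => f; rewrite !inE mem_star.
by move=> /andP[_ /andP[/asboolP Gf _]]; exact/ltW/len_gt0.
Qed.

(* An edge incident with [X] meets [X] in one or two vertices, and the vertices
   of [X] are interior to the subgraph of these edges. *)
Lemma bdry_ratio_incident_edges X : X != fset0 -> [set` X] `<=` ~` dirichlet G ->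
  2^-1 * bdry_ratio (edge_subgraph (incident_edges X)) <=
  #|` fset_set (edge_boundary G X)|%:R / set_weight G X.
Proof.
move=> X0 XD; set F := incident_edges X.
have FG : [set` F] `<=` edges G by move=> e /incident_edgesP[].
have XF v : v \in X -> star (edges G) v `<=` [set` F] by exact: star_incident_edges.
have F0 : F != fset0.
  have /fset0Pn[v vX] := X0; have [e Ge ve] := exists_incident_edge v.
  by apply/fset0Pn; exists e; exact: (XF v).
have wX := set_weight_gt0 X0.
have mF : 0 < mes G (edge_subgraph F) by exact: mes_gt0.
have wm : set_weight G X <= 2 * mes G (edge_subgraph F).
  rewrite (set_weight_sum FG XF) /mes mulr_sumr big_seq [leRHS]big_seq.
  apply: ler_sum => e /FG Ge.
  rewrite -[leLHS]mulr_natl ler_wpM2r//; first exact/ltW/len_gt0.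
  by rewrite ler_nat -(edge_card Ge) fsubset_leq_card// fsubsetIl.
have db : (deg_boundary G (edge_subgraph F))%:R <=
    #|` fset_set (edge_boundary G X)|%:R :> R.
  rewrite deg_boundaryE (card_edge_boundary FG XF) big_seq [leRHS]big_seq.
  apply: ler_sum => e eF; rewrite ler_nat.
  have [Ge [x xX xe]] := incident_edgesP eF.
  have interior z : z \in X -> z \notin boundary G (edge_subgraph F).
    move=> zX; rewrite !inE /= negb_and negb_or asboolF; last exact: XD.
    rewrite -leqNgt /= orbC /deg /sub_deg /= fsubset_leq_card//.
    apply/fsubsetP => f; rewrite mem_star => /andP[/asboolP Gf zf].
    by rewrite !inE /= zf andbT; apply: (XF z).
  have [->|/fset0Pn[y]] := eqVneq (e `&` boundary G (edge_subgraph F))%fset fset0.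
    by rewrite cardfs0.
  rewrite inE => /andP[ye yb].
  have yX : y \notin X by apply: contraL yb; exact: interior.
  (* The endpoint [x] is interior, so a boundary endpoint [y] is the other end [z]. It lies outside
     [X], so [e] is a boundary edge of [X] and contributes exactly 1 on both sides. *)
  have [z zx ez] := edge_pair Ge xe.
  have yz : y = z.
    by move: ye; rewrite ez !inE => /orP[/eqP yx|/eqP//]; move: yX; rewrite yx xX.
  rewrite asboolT /=; last by split=> //; exists x, z; rewrite -yz in ez *.
  rewrite -(cardfs1 y) fsubset_leq_card//; apply/fsubsetP => w.
  rewrite !inE ez !inE => /andP[/orP[/eqP ->|/eqP -> _]]; last by rewrite yz.
  by move: (interior x xX); rewrite !inE => /negbTE ->.
rewrite /bdry_ratio mulrA [2^-1 * _]mulrC -mulrA -invfM.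
apply: ler_pM => //; first by rewrite invr_ge0 ltW// mulr_gt0.
by rewrite lef_pV2 ?posrE// mulr_gt0.
Qed.

(* [X] is the set of interior vertices of [H]. Each edge of [H] is counted
   twice in the sum of the incident lengths over the vertices of [H]; interior
   vertices contribute [m(X)] and each boundary incidence at most [L]. *)
Lemma mes_le_interior H (L : R) : finite_connected_subgraphs G H -> 0 <= L ->
  (forall e, e \in sub_edges H -> len G e <= L) ->
  let X := (sub_vertices H `\` boundary G H)%fset in
  [/\ forall v, v \in X -> star (edges G) v `<=` [set` sub_edges H],
      2 * mes G H <= set_weight G X + (deg_boundary G H)%:R * L &
      #|` fset_set (edge_boundary G X)|%:R <= (deg_boundary G H)%:R :> R].
Proof.
move=> [H0 HG HV _] L0 HL X.
have XF v : v \in X -> star (edges G) v `<=` [set` sub_edges H].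
  rewrite !inE => /andP[+ vH].
  rewrite vH /= negb_or -leqNgt => /andP[_ vdeg] e [Ge ve] /=.
  (* The edges of [H] at [v] form a subset of the star with at least as many elements, hence all of
     it. *)
  have sub : ([fset e in sub_edges H | v \in e] `<=` fset_set (star (edges G) v))%fset.
    apply/fsubsetP => f; rewrite mem_star !inE /= => /andP[fH ->]; rewrite andbT.
    exact/asboolP/HG.
  have : e \in fset_set (star (edges G) v) by rewrite mem_star ve andbT; exact/asboolP.
  have /eqP <- : ([fset e in sub_edges H | v \in e] == fset_set (star (edges G) v))%fset.
    by rewrite eqEfcard sub.
  by rewrite !inE => /andP[].
split=> //.
  rewrite (set_weight_sum HG XF) deg_boundaryE /mes mulr_sumr mulr_suml -big_split /=.
  rewrite big_seq [leRHS]big_seq; apply: ler_sum => e eH.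
  (* The two endpoints of [e] are distributed among interior and boundary vertices. *)
  have -> : 2 * len G e = len G e *+ #|` e `&` X|%fset +
      #|` e `&` boundary G H|%fset%:R * len G e.
    rewrite !mulr_natl -mulrnDr; congr (_ *+ _).
    rewrite -(edge_card (HG _ eH)) -(cardfsID (boundary G H) e) addnC.
    congr (_ + _)%N; congr (#|` _|); apply/fsetP => x; rewrite !inE.
    by case: (boolP (x \in e)) => xe; rewrite ?andbF//= (fsubsetP (HV _ eH) x xe) andbT.
  by rewrite lerD2l ler_wpM2l// HL.
rewrite deg_boundaryE (card_edge_boundary HG XF) big_seq [leRHS]big_seq.
apply: ler_sum => e eH; rewrite ler_nat.
case: asboolP => //= -[_ [x [y [_ yX ee]]]].
(* The endpoint outside [X] is still a vertex of [H], so it is a boundary vertex. *)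
rewrite cardfs_gt0; apply/fset0Pn; exists y.
have ye : y \in e by rewrite ee !inE eqxx orbT.
have yH := fsubsetP (HV _ eH) y ye.
by move: yX; rewrite inE ye inE yH andbT negbK.
Qed.

(** * Enlarging finite connected subgraphs *)

Lemma finite_connected_add_edge H u w : finite_connected_subgraphs G H ->
  u \in sub_vertices H -> edges G [fset u; w]%fset ->
  finite_connected_subgraphs G
    (Subgraph (w |` sub_vertices H)%fset ([fset u; w] |` sub_edges H)%fset).
Proof.
move=> [H0 HG HV Hc] uH uw; split=> /=.
- by apply/fset0Pn; exists [fset u; w]%fset; rewrite !inE eqxx.
- by move=> e /=; rewrite !inE => /orP[/eqP ->|/HG].
- move=> e; rewrite !inE => /orP[/eqP ->|/HV eH].
    by apply/fsubsetP => x; rewrite !inE => /orP[/eqP ->|->]//; rewrite uH orbT.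
  by apply: fsubset_trans eH _; exact: fsubsetUr.
apply: (@walk_connected_root _ _ _ u) => v /=; rewrite !inE => /orP[/eqP ->|vH].
  by apply: reachable_edge; rewrite /= !inE eqxx.
apply: reachable_sub (Hc _ _ uH vH) => e /= eH.
by rewrite !inE eH orbT.
Qed.

Lemma finite_connected_add_walk H u p : finite_connected_subgraphs G H ->
  u \in sub_vertices H -> path (fun x y => `[< edges G [fset x; y]%fset >]) u p ->
  exists K, [/\ finite_connected_subgraphs G K,
    (sub_edges H `<=` sub_edges K)%fset & last u p \in sub_vertices K].
Proof.
elim: p H u => [|w p IH] H u KH uH /=; first by exists H.
move=> /andP[/asboolP uw wp].
have [|K [? HK ?]] := IH _ w (finite_connected_add_edge KH uH uw) _ wp.
  by rewrite !inE eqxx.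
by exists K; split=> //; apply: fsubset_trans HK; exact: fsubsetUr.
Qed.

Lemma finite_connected_edge e : edges G e ->
  finite_connected_subgraphs G (Subgraph e [fset e]%fset).
Proof.
move=> Ge; split=> /=.
- by apply/fset0Pn; exists e; rewrite !inE.
- by move=> f /=; rewrite !inE => /eqP ->.
- by move=> f; rewrite !inE => /eqP ->.
have [u ue] := edge_nonempty Ge.
have [w _ ee] := edge_pair Ge ue.
apply: (@walk_connected_root _ _ _ u) => v /=; rewrite {1}ee !inE.
move=> /orP[/eqP ->|/eqP ->]; first exact: reachable_refl.
by apply: reachable_edge; rewrite /= -ee !inE.
Qed.

(** A walk from a vertex of [H] to an endpoint of [e] is added first, then [e] itself. *)
Lemma finite_connected_add H e : finite_connected_subgraphs G H -> edges G e ->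
  exists K, [/\ finite_connected_subgraphs G K,
    (sub_edges H `<=` sub_edges K)%fset & e \in sub_edges K].
Proof.
move=> KH Ge; have [H0 HG HV _] := KH.
have /fset0Pn[f fH] := H0.
have [u uf] := edge_nonempty (HG _ fH).
have [v ve] := edge_nonempty Ge.
have [w _ ee] := edge_pair Ge ve.
have [p [up lastp]] := @graph_connected _ _ G u v I I.
have [K [KK HK]] := finite_connected_add_walk KH (fsubsetP (HV _ fH) u uf) up.
rewrite lastp => vK.
rewrite ee in Ge.
exists (Subgraph (w |` sub_vertices K)%fset
  ([fset v; w] |` sub_edges K)%fset).
split=> /=; first exact: finite_connected_add_edge.
  by apply: fsubset_trans HK _; exact: fsubsetUr.
by rewrite ee !inE eqxx.
Qed.

Lemma edges_setD_nonempty F : exists e, edges G e /\ e \notin F.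
Proof.
have infE : infinite_set (edges G `\` [set` F]).
  apply: infinite_setD; last exact: finite_fset.
  by rewrite (eq_finite_set (edges_countably_infinite G)); exact: infinite_nat.
have [e [Ge /= /negP eF]] : (edges G `\` [set` F]) !=set0.
  by apply/set0P/eqP => E0; apply: infE; rewrite E0.
by exists e.
Qed.

Lemma finite_connected_cover F : [set` F] `<=` edges G ->
  exists2 H, finite_connected_subgraphs G H & (F `<=` sub_edges H)%fset.
Proof.
move=> FG; suff [H KH FH] : exists2 H, finite_connected_subgraphs G H &
    {subset enum_fset F <= sub_edges H} by exists H => //; exact/fsubsetP.
have {FG} : forall e, e \in enum_fset F -> edges G e by move=> e /FG.
elim: (enum_fset F) => [_|e s IH sG].
  (* Even for empty [F] the subgraph must have an edge, so the induction starts from an arbitrary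
     one. *)
  have [e [Ge _]] := edges_setD_nonempty fset0.
  by exists (Subgraph e [fset e]%fset) => //; exact: finite_connected_edge.
have [|H KH sH] := IH; first by move=> f fs; apply: sG; rewrite inE fs orbT.
have [|K [KK HK eK]] := finite_connected_add KH (e := e).
  by apply: sG; rewrite inE eqxx.
exists K => // f; rewrite inE => /orP[/eqP ->//|/sH]; exact: fsubsetP.
Qed.

(** * Comparison of the isoperimetric constants *)

Local Open Scope ereal_scope.

(** Treats both cases at once: empty [S] gives [alpha], and [S = sub_edges H] gives
    [alpha_minus G H]. *)
Definition connected_avoiding S : set (subgraph V) :=
  finite_connected_subgraphs G `&` [set H | [disjoint sub_edges H & S]%fset].

Lemma isoperimetric_ge0 S : 0 <= isoperimetric G (connected_avoiding S).
Proof.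
apply: le_ereal_inf_tmp => _ [H [[H0 HG _ _] _] <-].
by rewrite lee_fin divr_ge0// ltW// mes_gt0.
Qed.

Lemma alpha_d_ge0 (Y : set V) : 0 <= alpha_d G Y.
Proof.
apply: le_ereal_inf_tmp => _ [X [X0 _] <-].
by rewrite lee_fin divr_ge0// ltW// set_weight_gt0.
Qed.

(** Since no vertex of [Y] touches [S], the edges incident with a subset of [Y] avoid [S], and so
    does the connected part extracted from them. *)
Lemma half_isoperimetric_le S (Y : set V) : Y `<=` ~` dirichlet G ->
  (forall e v, e \in S -> v \in e -> ~ Y v) ->
  (2^-1)%:E * isoperimetric G (connected_avoiding S) <= alpha_d G Y.
Proof.
move=> YD SY; apply: le_ereal_inf_tmp => _ [X [X0 XY] <-].
have XD : [set` X] `<=` ~` dirichlet G by move=> v /XY /YD.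
apply: le_trans
  (_ : (2^-1 * bdry_ratio (edge_subgraph (incident_edges X)))%:E <= _); last first.
  by rewrite lee_fin; exact: bdry_ratio_incident_edges.
have F0 : incident_edges X != fset0.
  have /fset0Pn[v vX] := X0; have [e Ge ve] := exists_incident_edge v.
  by apply/fset0Pn; exists e; exact: (star_incident_edges vX).
have FG : [set` incident_edges X] `<=` edges G by move=> e /incident_edgesP[].
have [H [KH HF Hle]] := connected_bdry_ratio_le F0 FG.
rewrite EFinM; apply: lee_wpmul2l; first by rewrite lee_fin invr_ge0.
apply: le_trans (_ : (bdry_ratio H)%:E <= _); last by rewrite lee_fin.
apply: ereal_inf_lbound; exists H => //; split=> //=.
apply/fdisjointP => e /(fsubsetP HF) /incident_edgesP[_ [v vX ve]].
by apply/negP => eS; exact: (SY _ _ eS ve) (XY _ vX).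
Qed.

(* [Z] must contain every vertex that can be interior to a subgraph avoiding
   [S], that is, every vertex without an edge in [S]. *)
Lemma inv_isoperimetric_le S (Z : set V) (L : R) : (0 <= L)%R ->
  (forall e, edges G e -> e \notin S -> (len G e <= L)%R) ->
  (forall v, star (edges G) v `<=` ~` [set` S] -> Z v) ->
  2%:E / isoperimetric G (connected_avoiding S) <= 1 / alpha_d G Z + L%:E.
Proof.
move=> L0 SL SZ; rewrite mul1e.
(* Here [c] stands for the inverse of [alpha_d G Z]. Stating the bound without division also admits
   [c = 0], needed when that constant is [+oo]. *)
have mes_le (c : R) : (0 <= c)%R ->
    (forall X, X != fset0 -> [set` X] `<=` Z ->
       set_weight G X <= c * #|` fset_set (edge_boundary G X)|%:R)%R ->
    2%:E / isoperimetric G (connected_avoiding S) <= (c + L)%:E.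
  move=> c0 weight_le; apply: lee_div_of_div_le; rewrite ?addr_ge0 ?isoperimetric_ge0//.
  apply: le_ereal_inf_tmp => _ [H [KH HS] <-].
  have [H0 HG _ _] := KH.
  have HL e : e \in sub_edges H -> (len G e <= L)%R.
    by move=> eH; apply: SL; [exact: HG|exact: (fdisjointP HS)].
  have [XH mesX bX] := mes_le_interior KH L0 HL.
  set X := (sub_vertices H `\` boundary G H)%fset in XH mesX bX.
  have wX : (set_weight G X <= c * (deg_boundary G H)%:R)%R.
    (* A subgraph may have no interior vertex. *)
    have [X0|X0] := eqVneq X fset0.
      by rewrite X0 /set_weight big_seq_fset0 mulr_ge0.
    apply: le_trans (weight_le _ X0 _) _; last by rewrite ler_wpM2l.
    move=> v /XH vH; apply: SZ => e /vH /= eH.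
    by apply/negP; exact: (fdisjointP HS).
  have mH := mes_gt0 H0 HG.
  have mcL : (2 * mes G H <= (deg_boundary G H)%:R * (c + L))%R by lra.
  have d0 : (0 <= (deg_boundary G H)%:R :> R)%R by [].
  have cL : (0 < c + L)%R.
    rewrite lt_neqAle addr_ge0// andbT; apply/eqP => cL0.
    by move: mcL; rewrite -cL0 mulr0; lra.
  by rewrite inver gt_eqF// -EFinM lee_fin ler_pdivrMr// mulrAC ler_pdivlMr.
have a0 := alpha_d_ge0 Z.
have alb X : X != fset0 -> [set` X] `<=` Z -> alpha_d G Z <=
    (#|` fset_set (edge_boundary G X)|%:R / set_weight G X)%:E.
  by move=> X0 XZ; apply: ereal_inf_lbound; exists X.
case: (alpha_d G Z) a0 alb => [a| |]// a0 alb.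
- rewrite lee_fin in a0; rewrite inver; case: eqVneq => [_|aN0].
    by rewrite addye// leey.
  have ap : (0 < a)%R by rewrite lt_neqAle eq_sym aN0.
  apply: mes_le; first by rewrite invr_ge0.
  move=> X X0 XZ; have := alb X X0 XZ.
  by rewrite lee_fin ler_pdivlMr ?set_weight_gt0// ler_pdivlMl.
(* An infimum of [+oo] means that [Z] has no nonempty finite subset, so the weight bound is
   vacuous. *)
- rewrite invey; apply: mes_le => // X X0 XZ.
  by have := alb X X0 XZ.
Qed.

Lemma alphaE : alpha G = isoperimetric G (connected_avoiding fset0).
Proof.
congr (isoperimetric G _); apply/seteqP; split=> [H KH|H []//].
by split=> //=; exact: fdisjointX0.
Qed.

(** Infinitely many edges remain outside [F], so the supremum is over a nonempty set of positive
    lengths and is not [-oo]. *)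
Lemma sup_len_fin F : ell_star G < +oo ->
  exists2 L : R, (0 <= L)%R &
    ereal_sup [set (len G e)%:E | e in edges G `\` [set` F]] = L%:E.
Proof.
move=> ell; set s := ereal_sup _.
have [e [Ge eF]] := edges_setD_nonempty F.
have s0 : 0 <= s.
  apply: le_trans (_ : (len G e)%:E <= _); first by rewrite lee_fin ltW// len_gt0.
  by apply: ereal_sup_ubound; exists e => //; split=> //=; exact/negP.
have soo : s < +oo.
  apply: le_lt_trans ell; apply: ge_ereal_sup => _ [f [Gf _] <-].
  by apply: ereal_sup_ubound; exists f.
by move: s s0 soo => [r| |]// r0 _; exists r.
Qed.

End MetricGraphTheory.

Local Open Scope ereal_scope.

(* The two lower bounds on discrete constants are over finite sets of
   non-Dirichlet vertices (all vertices when V_D is empty): Dirichlet vertices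
   count in the boundary of a subgraph but not in the edge boundary of a vertex
   set, and with the whole of V both bounds fail on an infinite comb whose
   teeth end in Dirichlet vertices. *)
Theorem lemma4p2 (R : realType) (V : choiceType) (G : metric_graph R V)
    (hlen : ell_star G < +oo) (hdeg : forall v, deg G v <> 2%N) :
  ((2^-1)%:E * alpha G <= alpha_d G (~` dirichlet G) /\
   2%:E / alpha G <= 1 / alpha_d G [set: V] + ell_star G) /\
  ((2^-1)%:E * alpha_ess G <= alpha_d_ess G (~` dirichlet G) /\
   2%:E / alpha_ess G <= 1 / alpha_d_ess G [set: V] + ell_star_ess G).
Proof.
split; split.
- by rewrite alphaE; apply: half_isoperimetric_le => // e v; rewrite inE.
- rewrite alphaE; have [L L0 EL] := sup_len_fin fset0 hlen.
  have ellE : ell_star G = L%:E.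
    rewrite -EL /ell_star; congr (ereal_sup (_ @` _)).
    by apply/seteqP; split=> [e Ge|e []//]; split=> //=.
  rewrite ellE; apply: inv_isoperimetric_le => // e Ge _.
  by rewrite -lee_fin -ellE; apply: ereal_sup_ubound; exists e.
(* The factor is moved to the right, leaving the bare supremum [alpha_ess] to be bounded term by
   term. *)
- rewrite -[leRHS]mul1e; have <- : (2^-1)%:E * 2%:E = 1 :> \bar R.
    by rewrite -EFinM mulVf// pnatr_eq0.
  rewrite -muleA; apply: lee_wpmul2l; first by rewrite lee_fin invr_ge0.
  apply: ge_ereal_sup => _ [H KH <-].
  have [_ _ HV _] := KH.
  have : (2^-1)%:E * alpha_minus G H <= alpha_d_ess G (~` dirichlet G).
    pose Y := ~` dirichlet G `\` [set` sub_vertices H].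
    apply: le_trans (half_isoperimetric_le (Y := Y) _ _) _.
    + by move=> v [].
    + by move=> e v eH ve [_]; apply; exact: (fsubsetP (HV _ eH)).
    + by apply: ereal_sup_ubound; exists (sub_vertices H).
  move=> /(lee_wpmul2l (x := 2%:E)); rewrite muleA -EFinM mulfV ?pnatr_eq0// mul1e.
  by apply; rewrite lee_fin.
have [H0 KH0] : finite_connected_subgraphs G !=set0.
  have [e [Ge _]] := edges_setD_nonempty G fset0.
  by exists (Subgraph e [fset e]%fset); exact: finite_connected_edge.
have T0 (H : subgraph V) : 0 <= alpha_minus G H by exact: isoperimetric_ge0.
have ess0 : 0 <= alpha_ess G.
  by apply: le_trans (T0 H0) _; apply: ereal_sup_ubound; exists H0.
(* Let [H] contain [F] and all edges at [X]. A subgraph avoiding [H] has its edges outside [F] and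
   its interior vertices outside [X]. *)
have bound (X : {fset V}) (F : {fset {fset V}}) : [set` F] `<=` edges G ->
    2%:E / alpha_ess G <= (alpha_d G ([set: V] `\` [set` X]))^-1 +
      ereal_sup [set (len G e)%:E | e in edges G `\` [set` F]].
  move=> FG; have FXG : [set` (F `|` incident_edges G X)%fset] `<=` edges G.
    by move=> e /=; rewrite inE => /orP[/FG//|/incident_edgesP[]].
  have [H KH HF] := finite_connected_cover FXG.
  apply: le_trans (_ : 2%:E / alpha_minus G H <= _).
    apply: lee_wpmul2l; first by rewrite lee_fin.
    by rewrite lee_pV2 ?inE ?T0//; apply: ereal_sup_ubound; exists H.
  have [L L0 EL] := sup_len_fin F hlen.
  rewrite EL -[_^-1 in leRHS]mul1e; apply: inv_isoperimetric_le => //.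
    move=> e Ge eH; rewrite -lee_fin -EL.
    apply: ereal_sup_ubound; exists e => //; split=> //=.
    by apply/negP; apply: contraNN eH => eF; apply: (fsubsetP HF); rewrite inE eF.
  move=> v sv; split=> //= vX; have [e Ge ve] := exists_incident_edge G v.
  have eX : e \in incident_edges G X by exact: (star_incident_edges vX).
  apply: (sv e) => //=; apply: (fsubsetP HF).
  by rewrite inE eX orbT.
have d0 : 0 <= alpha_d_ess G [set: V].
  apply: le_trans (alpha_d_ge0 G ([set: V] `\` [set` fset0])) _.
  by apply: ereal_sup_ubound; exists fset0.
have sup_bound (F : {fset {fset V}}) : [set` F] `<=` edges G ->
    2%:E / alpha_ess G <= (alpha_d_ess G [set: V])^-1 +
      ereal_sup [set (len G e)%:E | e in edges G `\` [set` F]].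
  move=> FG; have [L L0 EL] := sup_len_fin F hlen; rewrite EL.
  rewrite -leeBlDr//.
  (* The supremum over [X] sits inside an inverse. For a positive left side, inverting twice reduces
     the claim to each single [X]; otherwise it is trivial. *)
  have [s0|s0] := leP (2%:E / alpha_ess G - L%:E) 0.
    by apply: le_trans s0 _; rewrite inve_ge0.
  rewrite inve_pge ?inE//; last exact: ltW.
  apply: ge_ereal_sup => _ [X _ <-].
  rewrite inve_pge ?inE ?alpha_d_ge0//; last exact: ltW.
  by rewrite leeBlDr// -EL; exact: bound.
rewrite mul1e.
(* A finite summand is subtracted before taking the infimum over [F]. If it is [+oo], the sum is
   [+oo] because [ell_star_ess G] is nonnegative. *)
case E : (alpha_d_ess G [set: V])^-1 => [c| |].
- rewrite addeC -leeBlDr//; apply: le_ereal_inf_tmp => _ [F FG <-].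
  by rewrite leeBlDr// addeC -E; exact: sup_bound.
- rewrite addye ?leey//; apply/eqP => ellNy.
  have : 0 <= ell_star_ess G; last by rewrite ellNy.
  apply: le_ereal_inf_tmp => _ [F FG <-].
  by have [L L0 ->] := sup_len_fin F hlen; rewrite lee_fin.
- by move: d0; rewrite -inve_ge0 E.
Qed.
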